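(* Let $K$ be a field, $S=K[x_1,\ldots,x_n]$ the polynomial ring, and $I\subset S$ a monomial ideal such that $S/I$ is a multigraded pretty clean ring. Then Stanley's conjecture holds for $S/I$, that is, there exists a Stanley decomposition $S/I=\bigoplus_{i=1}^r u_iK[Z_i]$ such that $|Z_i|\ge\operatorname{depth}S/I$ for all $i=1,\ldots,r$.
   Context: $S/I$ is a multigraded pretty clean ring if there is a filtration $0=M_0\subset M_1\subset\cdots\subset M_r=S/I$ by multigraded ($\mathbb{Z}^n$-graded) submodules with multigraded isomorphisms $M_i/M_{i-1}\cong S/P_i(-a_i)$, $a_i\in\mathbb{Z}^n$, $P_i$ a monomial prime ideal, such that for all $i<j$ with $P_i\subset P_j$ one has $P_i=P_j$. Identify $S/I$ with the $K$-span of the monomials of $S$ not belonging to $I$. A Stanley decomposition of $S/I$ is a finite direct sum decomposition $S/I=\bigoplus_{i=1}^r u_iK[Z_i]$ as $K$-vector spaces, where each $u_i$ is a monomial of $S$, $Z_i\subset\{x_1,\dots,x_n\}$, and $u_iK[Z_i]$ is the $K$-span of all monomials $u_iv$ with $v$ a monomial in the variables of $Z_i$. *)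

(* Defs.v *)
From HB Require Import structures.
From mathcomp Require Import all_boot all_order all_algebra.
From mathcomp Require Import mpoly.
From Stdlib Require Import ClassicalEpsilon.

Set Implicit Arguments.
Unset Strict Implicit.
Unset Printing Implicit Defensive.

Import GRing.Theory.
Local Open Scope ring_scope.
Local Open Scope quotient_scope.

Record submodule (R : comNzRingType) (V : lmodType R) := Submodule {
  submod_pred :> {pred V};
  submod_predP : submod_closed submod_pred
}.

HB.instance Definition _ (R : comNzRingType) (V : lmodType R)
    (W : submodule V) :=
  GRing.isSubmodClosed.Build R V (submod_pred W) (submod_predP W).

(* The submodules of R^o are the ideals of R. Unlike [idealr R] these include
   the unit ideal. *)
Definition ideal (R : comNzRingType) := @submodule R R^o.

Section SubmoduleType.
Variables (R : comNzRingType) (V : lmodType R) (W : submodule V).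

Inductive submod_of : predArgType := Submod u & u \in W.
Definition submod_val (w : submod_of) : V := let: Submod u _ := w in u.

HB.instance Definition _ := [isSub of submod_of for submod_val].
HB.instance Definition _ := [Choice of submod_of by <:].
HB.instance Definition _ := [SubChoice_isSubZmodule of submod_of by <:].
HB.instance Definition _ := [SubZmodule_isSubLmodule of submod_of by <:].

End SubmoduleType.

Section RestrictedSubmodule.
Variables (R : comNzRingType) (V : lmodType R) (W W' : submodule V).

Fact submod_restr_closed :
  submod_closed [pred w : submod_of W | submod_val w \in W'].
Proof.
split=> [|c u v]; rewrite !inE /=; first exact: rpred0.
by move=> uW' vW'; rewrite rpredD // rpredZ.
Qed.

(* W' as a submodule of W (that is, the intersection of W and W') *)
Definition submod_restr := Submodule submod_restr_closed.

End RestrictedSubmodule.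

Section QuotientModule.
Variables (R : comNzRingType) (V : lmodType R) (W : submodule V).

Definition quotmod := Quotient.quot W.

HB.instance Definition _ := GRing.Zmodule.on quotmod.

Definition quotmod_pi (v : V) : quotmod := \pi_(Quotient.quot W) v.

Definition quotmod_scale (c : R) (x : quotmod) : quotmod :=
  quotmod_pi (c *: repr (x : Quotient.quot W)).

Lemma quotmod_piP (u v : V) : quotmod_pi u = quotmod_pi v <-> u - v \in W.
Proof.
rewrite /quotmod_pi; split=> [/eqP|]; first by rewrite -Quotient.idealrBE.
by rewrite Quotient.idealrBE => /eqP.
Qed.

Lemma quotmod_pi_surj (x : quotmod) : exists v, quotmod_pi v = x.
Proof. by exists (repr (x : Quotient.quot W)); rewrite /quotmod_pi reprK. Qed.

Lemma quotmod_piD (u v : V) : quotmod_pi (u + v) = quotmod_pi u + quotmod_pi v.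
Proof. exact: (raddfD (\pi_(Quotient.quot W))). Qed.

Lemma quotmod_piZ (c : R) (v : V) :
  quotmod_pi (c *: v) = quotmod_scale c (quotmod_pi v).
Proof.
apply/quotmod_piP; rewrite -scalerBr rpredZ //.
apply/quotmod_piP.
by rewrite {1}/quotmod_pi -[LHS]reprK.
Qed.

Fact quotmod_scaleA (c d : R) (x : quotmod) :
  quotmod_scale c (quotmod_scale d x) = quotmod_scale (c * d) x.
Proof. by have [v <-] := quotmod_pi_surj x; rewrite -!quotmod_piZ scalerA. Qed.

Fact quotmod_scale1 : left_id 1 quotmod_scale.
Proof.
by move=> x; have [v <-] := quotmod_pi_surj x; rewrite -quotmod_piZ scale1r.
Qed.

Fact quotmod_scaleDr : right_distributive quotmod_scale +%R.
Proof.
move=> c x y; have [u <-] := quotmod_pi_surj x; have [v <-] := quotmod_pi_surj y.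
by rewrite -quotmod_piD -!quotmod_piZ scalerDr quotmod_piD.
Qed.

Fact quotmod_scaleDl (x : quotmod) :
  {morph quotmod_scale^~ x : c d / c + d}.
Proof.
move=> c d; have [v <-] := quotmod_pi_surj x.
by rewrite -!quotmod_piZ scalerDl quotmod_piD.
Qed.

HB.instance Definition _ := GRing.Zmodule_isLmodule.Build R quotmod
  quotmod_scaleA quotmod_scale1 quotmod_scaleDr quotmod_scaleDl.

Fact quotmod_pi_is_linear : linear quotmod_pi.
Proof. by move=> c u v; rewrite quotmod_piD quotmod_piZ. Qed.

HB.instance Definition _ := GRing.isLinear.Build R V quotmod _ quotmod_pi
  quotmod_pi_is_linear.

End QuotientModule.

Section Depth.
Variables (R : comNzRingType) (V : lmodType R).

(* v belongs to (f_1, ..., f_d)V *)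
Definition in_mulmod (fs : seq R) (v : V) : Prop :=
  exists w : 'I_(size fs) -> V, v = \sum_(j < size fs) fs`_j *: w j.

(* f_1, ..., f_d is a V-regular sequence: f_(k+1) is a nonzerodivisor on
   V/(f_1, ..., f_k)V for each k < d, and (f_1, ..., f_d)V <> V. *)
Definition regular_seq (fs : seq R) : Prop :=
  (forall k, (k < size fs)%N -> forall v : V,
     in_mulmod (take k fs) (fs`_k *: v) -> in_mulmod (take k fs) v)
  /\ exists v : V, ~ in_mulmod fs v.

Variable J : R -> Prop.

Definition is_grade (d : nat) : Prop :=
  (exists fs : seq R,
     [/\ forall f, f \in fs -> J f, regular_seq fs & size fs = d]) /\
  (forall fs : seq R,
     (forall f, f \in fs -> J f) -> regular_seq fs -> (size fs <= d)%N).

(* The value is unspecified when the lengths of the V-regular sequences in J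
   have no maximum, in particular when V = 0. *)
Definition grade : nat := epsilon (inhabits 0%N) is_grade.

Lemma gradeE d : is_grade d -> grade = d.
Proof.
move=> dP; have : is_grade grade by apply: epsilon_spec; exists d.
case: dP => [[fs [fsJ fsR <-]] fs_max] [[gs [gsJ gsR gsE]] gs_max].
by apply/eqP; rewrite eqn_leq -{1}gsE fs_max ?gs_max.
Qed.

End Depth.

Section Multigraded.
Variables (K : fieldType) (n : nat).
Local Notation S := {mpoly K[n]}.
Local Notation Zn := {ffun 'I_n -> int}.

(* A grading is given by its homogeneous components: G a v means that v
   belongs to the component of degree a (so that G a 0 always holds). *)
Definition grading (V : lmodType S) := Zn -> V -> Prop.

Definition graded_ring : grading S^o := fun a p =>
  forall m, m \in msupp (p : S) -> forall i : 'I_n, a i = (m i)%:Z.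

Definition graded_quot (V : lmodType S) (G : grading V) (W : submodule V) :
    grading (quotmod W) :=
  fun a x => exists2 v, G a v & x = quotmod_pi W v.
#[global] Arguments graded_quot [V] G W.

Definition graded_sub (V : lmodType S) (G : grading V) (W : submodule V) :
    grading (submod_of W) :=
  fun a w => G a (submod_val w).
#[global] Arguments graded_sub [V] G W.

(* V(-b) *)
Definition graded_shift (V : lmodType S) (G : grading V) (b : Zn) : grading V :=
  fun a v => G (a - b) v.

Definition multigraded_submod (V : lmodType S) (G : grading V)
    (W : submodule V) : Prop :=
  forall v, v \in W -> exists s : seq V,
    (forall w, w \in s -> w \in W /\ exists a, G a w) /\ v = \sum_(w <- s) w.

Definition multigraded_iso (U V : lmodType S) (GU : grading U) (GV : grading V)
    : Prop :=
  exists f : {linear U -> V},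
    bijective f /\ forall a u, GU a u <-> GV a (f u).

Definition in_maxideal (f : S) : Prop :=
  exists c : 'I_n -> S, f = \sum_i c i * 'X_i.

(* For S-modules V multigraded and finitely generated, the depth is taken with
   respect to the graded maximal ideal. *)
Definition depth (V : lmodType S) : nat := grade V in_maxideal.

Definition monomial_ideal (I : ideal S) : Prop :=
  exists A : 'X_{1..n} -> Prop, forall p : S,
    p \in I <-> exists s : seq (S * 'X_{1..n}),
      (forall t, t \in s -> A t.2) /\ p = \sum_(t <- s) t.1 * 'X_[t.2].

Definition prime_ideal (P : ideal S) : Prop :=
  (1 : S) \notin P /\ prime_idealr_closed (R := S) P.

Local Notation graded_cyclic I := (graded_quot graded_ring I).

Definition pretty_clean (I : ideal S) : Prop :=
  exists (r : nat) (M : nat -> submodule (quotmod I)) (P : nat -> ideal S)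
         (a : nat -> Zn),
  [/\ (forall x, (x \in M 0%N) = (x == 0)) /\ (forall x, x \in M r),
      forall i, (i <= r)%N -> multigraded_submod (graded_cyclic I) (M i),
      forall i, (i < r)%N -> {subset M i <= M i.+1},
      forall i, (i < r)%N ->
        [/\ monomial_ideal (P i), prime_ideal (P i)
          & multigraded_iso
              (graded_quot (graded_sub (graded_cyclic I) (M i.+1))
                 (submod_restr (M i.+1) (M i)))
              (graded_shift (graded_cyclic (P i)) (a i))]
    & forall i j, (i < j < r)%N -> {subset P i <= P j} -> P i =i P j].

(* K-span of a set of monomials *)
Definition mon_span (A : 'X_{1..n} -> Prop) (p : S) : Prop :=
  forall m, m \in msupp p -> A m.

(* u K[Z], where Z stands for the set of variables x_i with i in Z *)
Definition stanley_space (u : 'X_{1..n}) (Z : {set 'I_n}) : S -> Prop :=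
  mon_span (fun m => exists v : 'X_{1..n},
    (forall i, i \notin Z -> v i = 0%N) /\ m = (u + v)%MM).

Definition direct_sum_decomposition (r : nat) (W : S -> Prop)
    (Wi : 'I_r -> S -> Prop) : Prop :=
  (forall i p, Wi i p -> W p) /\
  (forall p, W p -> exists! q : {ffun 'I_r -> S},
     (forall i, Wi i (q i)) /\ p = \sum_i q i).

Definition stanley_decomposition (I : ideal S) (r : nat)
    (u : 'I_r -> 'X_{1..n}) (Z : 'I_r -> {set 'I_n}) : Prop :=
  direct_sum_decomposition
    (mon_span (fun m => 'X_[m] \notin I))
    (fun i => stanley_space (u i) (Z i)).

End Multigraded.

(* Main.v *)
(* The factor M_(i+1)/M_i = S/P_i(-a_i) of a prime filtration is spanned by the
   monomials of u_i K[Z_i], where u_i is the monomial lifting its generator and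
   Z_i is the set of variables outside P_i; this gives the Stanley
   decomposition.  Pretty cleanness makes every P_i an associated prime of S/I,
   so the bound amounts to: if v is not in I and x_k v is in I for all x_k
   outside Z, then an S/I-regular sequence f_1, ..., f_d in the maximal ideal
   has length d <= |Z|.  Suppose d > |Z|.  For each N the powers f_j^N are
   algebraically dependent in K[Z], and therefore satisfy a polynomial relation
   F(f_1^N, ..., f_d^N) v = 0 in S/I.  They form again a regular sequence, so
   the relation puts v in (f_1^N, ..., f_d^N)(S/I); comparing degrees for large
   N gives v in I. *)
Require Import Defs.
From mathcomp Require Import all_boot all_order all_algebra.
From mathcomp Require Import mpoly.
From Stdlib Require Import Classical.

Set Implicit Arguments.
Unset Strict Implicit.
Unset Printing Implicit Defensive.

Import GRing.Theory.
Local Open Scope ring_scope.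

(** * Weakly regular sequences *)

Section WeaklyRegular.
Variables (R : comUnitRingType) (V : lmodType R).
Implicit Types (f g h : R) (fs : seq R) (W : V -> Prop) (u v w : V).

Definition submod_prop W := W 0 /\ forall c u v, W u -> W v -> W (c *: u + v).

(** The submodule [W + fV]. Submodules are [Prop] predicates here, since this existential need not
    be decidable. *)
Definition adjoin f W v := exists w, W (v - f *: w).

Fixpoint adjoins fs W :=
  if fs is f :: fs' then adjoins fs' (adjoin f W) else W.

(* [fs] is a weakly regular sequence on V/W. *)
Fixpoint weakly_regular W fs : Prop :=
  if fs is f :: fs' then
    (forall v, W (f *: v) -> W v) /\ weakly_regular (adjoin f W) fs'
  else True.

Lemma submod_propD W u v : submod_prop W -> W u -> W v -> W (u + v).
Proof. by move=> [_ WD] Wu Wv; rewrite -[u]scale1r; apply: WD. Qed.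

Lemma submod_propZ W c u : submod_prop W -> W u -> W (c *: u).
Proof. by move=> [W0 WD] Wu; rewrite -[c *: u]addr0; apply: WD. Qed.

Lemma submod_propB W u v : submod_prop W -> W u -> W v -> W (u - v).
Proof. by move=> [_ WD] Wu Wv; rewrite addrC -scaleN1r; apply: WD. Qed.

Lemma submod_prop_adjoin f W : submod_prop W -> submod_prop (adjoin f W).
Proof.
move=> subW; split=> [|c u v [u' Wu] [v' Wv]].
  by exists 0; rewrite scaler0 subr0; case: subW.
exists (c *: u' + v'); have [_ /(_ c _ _ Wu Wv)] := subW.
by rewrite scalerBr scalerDr !scalerA [f * c]mulrC opprD addrACA.
Qed.

Lemma adjoinC f g W v : adjoin f (adjoin g W) v -> adjoin g (adjoin f W) v.
Proof.
by move=> [u [w Wuw]]; exists w, u; rewrite -addrA [- _ - _]addrC addrA.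
Qed.

Lemma eq_weakly_regular W W' fs : (forall v, W v <-> W' v) ->
  weakly_regular W fs -> weakly_regular W' fs.
Proof.
elim: fs W W' => //= f fs IH W W' eqW [regf regfs]; split.
  by move=> v; rewrite -!eqW; apply: regf.
by apply: IH regfs => v; split=> -[w Ww]; exists w; apply/eqW.
Qed.

(** If [f v = h w] modulo [W], regularity of [h] modulo [f] gives [w = f w'] modulo [W]; cancelling
    [f] then gives [v = h w'] modulo [W]. The tail only needs [adjoinC]. *)
Lemma weakly_regular_swap W f h fs : submod_prop W ->
  weakly_regular W (f :: h :: fs) -> weakly_regular (adjoin h W) (f :: fs).
Proof.
move=> subW /= [regf [regh regfs]]; split=> [v [w Wvw]|]; last first.
  by apply: eq_weakly_regular regfs => v; split; apply: adjoinC.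
have [w' Ww'] : adjoin f W w.
  apply: regh; exists v; have := submod_propZ (-1) subW Wvw.
  by rewrite scaleN1r opprB.
exists w'; apply: regf; have := submod_propD subW Wvw (submod_propZ h subW Ww').
by rewrite !scalerBr !scalerA [h * f]mulrC addrA subrK.
Qed.

(** Induction on the tail: working modulo its head [h], by [weakly_regular_swap], settles the rest.
    For [h] itself, [h v = f g w] modulo [W] forces [v = f v0], and then, after cancelling [f],
    [v0 = g v1]. *)
Lemma weakly_regularM W f g fs : submod_prop W ->
  weakly_regular W (f :: fs) -> weakly_regular W (g :: fs) ->
  weakly_regular W (f * g :: fs).
Proof.
elim: fs W => [|h fs IH] W subW regf regg.
  case: regf regg => regf _ [regg _]; split=> // v.
  by rewrite -scalerA => /regf/regg.
have := IH _ (submod_prop_adjoin h subW) (weakly_regular_swap subW regf)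
             (weakly_regular_swap subW regg).
move: regf regg => [regf [reghf _]] [regg [reghg _]] /= [_ regfs].
split; first by move=> v; rewrite -scalerA => /regf/regg.
split; last by apply: eq_weakly_regular regfs => v; split; apply: adjoinC.
move=> v [w Ww].
have [v0 Wv0] : adjoin f W v by apply: reghf; exists (g *: w); rewrite scalerA.
have [v1 Wv1] : adjoin g W v0.
  apply: reghg; exists w; apply: regf.
  have := submod_propB subW Ww (submod_propZ h subW Wv0).
  by rewrite !scalerBr !scalerA [h * f]mulrC opprB addrC addrA subrK.
exists v1; have := submod_propD subW Wv0 (submod_propZ f subW Wv1).
by rewrite scalerBr scalerA addrA subrK.
Qed.

Lemma weakly_regularX W fs N : submod_prop W -> weakly_regular W fs ->
  weakly_regular W [seq f ^+ N.+1 | f <- fs].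
Proof.
elim: fs W => [//|f fs IH] W subW reg.
have: weakly_regular W (f ^+ N.+1 :: fs).
  by elim: N {IH} => [//|N IHN]; rewrite exprS; apply: weakly_regularM.
by case=> regf regfs; split=> //; apply: IH regfs; apply: submod_prop_adjoin.
Qed.

Definition power_prod fs (a : seq nat) := \prod_(p <- zip fs a) p.1 ^+ p.2.

Lemma power_prod_cons f fs i a :
  power_prod (f :: fs) (i :: a) = f ^+ i * power_prod fs a.
Proof. by rewrite /power_prod /= big_cons. Qed.

(* Factoring out the lowest power of the first element and reducing modulo
   that element leaves a relation among the remaining ones. *)
Lemma weakly_regular_torsion W fs (A : seq (R * seq nat)) u :
  submod_prop W -> weakly_regular W fs ->
  A != [::] -> uniq (unzip2 A) ->
  (forall t, t \in A -> t.1 \is a GRing.unit /\ size t.2 = size fs) ->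
  W ((\sum_(t <- A) t.1 * power_prod fs t.2) *: u) -> adjoins fs W u.
Proof.
elim: fs W A => [|f fs IH] W A subW.
  (* All exponent lists are empty here, so uniqueness leaves a single term, whose unit coefficient
     can be inverted. *)
  move=> _ A0 uA tA; case: A A0 uA tA => [//|[c a] A] _ uA tA.
  have [c_unit /size0nil/= a0] := tA _ (mem_head _ _).
  case: A uA tA => [|[c' a'] A] uA tA; last first.
    have [_ /size0nil/= a0'] : (c', a').1 \is a GRing.unit /\ size (c', a').2 = 0%N.
      by apply: tA; rewrite in_cons mem_head orbT.
    by move: uA; rewrite /= a0 a0' in_cons eqxx.
  rewrite big_seq1 a0 /power_prod big_nil mulr1 => /(submod_propZ c^-1 subW).
  by rewrite scalerA mulVr // scale1r.
move=> [regf regfs] A0 uA tA.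
have exA : exists i, has (fun t => head 0%N t.2 == i) A.
  by case: A A0 {uA tA} => [//|t A] _; exists (head 0%N t.2); rewrite /= eqxx.
case: (ex_minnP exA) => i /hasP[t0 At0 /eqP t0i] i_min.
have {}i_min t : t \in A -> (i <= head 0%N t.2)%N.
  by move=> At; apply: i_min; apply/hasP; exists t.
(* The terms that survive modulo [f] once [f ^+ i] is cancelled. Their first exponent is constantly
   [i], so dropping it keeps the exponent lists distinct. *)
pose A' := [seq (t.1, behead t.2) | t <- A & head 0%N t.2 == i].
have conss t : t \in A -> t.2 = head 0%N t.2 :: behead t.2.
  by move=> /tA[_]; case: t.2.
have sumE : \sum_(t <- A) t.1 * power_prod (f :: fs) t.2 = f ^+ i *
    \sum_(t <- A) t.1 * f ^+ (head 0 t.2 - i) * power_prod fs (behead t.2).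
  rewrite big_distrr /= 2!big_seq; apply: eq_bigr => t At.
  rewrite {1}(conss _ At) power_prod_cons -{1}(subnKC (i_min _ At)) exprD.
  by rewrite -!mulrA mulrCA.
rewrite sumE -scalerA => {sumE} Wu.
have regfX k v : W (f ^+ k *: v) -> W v.
  by elim: k => [|k IHk]; rewrite ?scale1r // exprS -scalerA => /regf.
move/regfX: Wu => {regfX} Wu.
apply: (IH _ A') => //=.
- exact: submod_prop_adjoin.
- rewrite -size_eq0 size_map size_filter -lt0n -has_count.
  by apply/hasP; exists t0; rewrite ?t0i.
- have -> : unzip2 A' = map behead [seq a <- unzip2 A | head 0%N a == i].
    by rewrite /A' /unzip2 filter_map -!map_comp.
  rewrite map_inj_in_uniq ?filter_uniq // => a b.
  rewrite !mem_filter => /andP[/eqP ai /mapP[t At at2]].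
  move=> /andP[/eqP bi /mapP[s As bs2]] ab.
  by rewrite at2 bs2 conss // [in RHS]conss // -at2 -bs2 ab ai bi.
- move=> t' /mapP[t]; rewrite mem_filter => /andP[_ At] -> /=.
  by have [? sz] := tA t At; rewrite size_behead sz.
rewrite big_map big_filter.
(* The remaining terms are still divisible by [f]; [X] is their sum divided by [f]. *)
pose X := \sum_(t <- A | head 0%N t.2 != i)
  t.1 * f ^+ (head 0%N t.2 - i).-1 * power_prod fs (behead t.2).
exists (- X *: u); move: Wu; rewrite scaleNr scalerN opprK scalerA -scalerDl.
congr (W (_ *: u)); rewrite (bigID (fun t => head 0%N t.2 == i)) /=; congr (_ + _).
  by apply: eq_bigr => t /eqP->; rewrite subnn expr0 mulr1.
rewrite /X big_distrr /= [LHS]big_seq_cond [RHS]big_seq_cond.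
apply: eq_bigr => t /andP[At ti].
have : (0 < head 0 t.2 - i)%N by rewrite subn_gt0 ltn_neqAle eq_sym ti i_min.
by case: (_ - i)%N => // k _; rewrite exprS /= !mulrA [f * _]mulrC.
Qed.

Lemma in_mulmod_nil v : in_mulmod [::] v <-> v = 0.
Proof.
split=> [[w ->]|->]; first by rewrite big_ord0.
by exists (fun=> 0); rewrite big_ord0.
Qed.

Lemma in_mulmod_cons f fs v :
  in_mulmod (f :: fs) v <-> exists w, in_mulmod fs (v - f *: w).
Proof.
split=> [[w ->]|[w0 [w vE]]].
  exists (w ord0), (fun j => w (lift ord0 j)).
  by rewrite big_ord_recl /= addrC addKr.
exists (fun j => if unlift ord0 j is Some k then w k else w0).
rewrite big_ord_recl unlift_none /=; under eq_bigr do rewrite liftK.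
by rewrite -vE subrKC.
Qed.

Lemma eq_adjoins W W' fs v : (forall v, W v <-> W' v) ->
  adjoins fs W v <-> adjoins fs W' v.
Proof.
elim: fs W W' => //= f fs IH W W' eqW; apply: IH => u.
by split=> -[w Ww]; exists w; apply/eqW.
Qed.

Lemma adjoins_adjoin W f fs v :
  adjoins fs (adjoin f W) v <-> exists w, adjoins fs W (v - f *: w).
Proof.
elim: fs W => //= g fs IH W; rewrite -IH.
by apply: eq_adjoins => u; split; apply: adjoinC.
Qed.

Lemma in_mulmodE fs v : in_mulmod fs v <-> adjoins fs (eq^~ 0) v.
Proof.
elim: fs v => [|f fs IH] v; first exact: in_mulmod_nil.
rewrite in_mulmod_cons /= adjoins_adjoin.
by split=> -[w Ww]; exists w; apply/IH.
Qed.

(** Generalising the zero submodule to any [W] lets the first element of each prefix be absorbed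
    into [W], which makes the induction on [fs] possible. *)
Lemma regular_seq_weakly fs : regular_seq V fs -> weakly_regular (eq^~ 0) fs.
Proof.
case=> reg _; have {}reg k : (k < size fs)%N -> forall v,
    adjoins (take k fs) (eq^~ 0) (fs`_k *: v) -> adjoins (take k fs) (eq^~ 0) v.
  by move=> ltk v /in_mulmodE/(reg k ltk)/in_mulmodE.
elim: fs (eq^~ 0) reg => //= f fs IH W reg; split.
  exact: (reg 0%N).
by apply: IH => k ltk v; apply: (reg k.+1).
Qed.

End WeaklyRegular.

(** * Dependence of polynomials modulo a monomial prime *)

Section MonomialDegrees.
Variables (K : fieldType) (n : nat).
Local Notation S := {mpoly K[n]}.
Implicit Types (p q f : S) (m : 'X_{1..n}) (fs : seq S).

Lemma mdeg_mul_le p q a b :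
  (forall m, m \in msupp p -> (mdeg m <= a)%N) ->
  (forall m, m \in msupp q -> (mdeg m <= b)%N) ->
  forall m, m \in msupp (p * q) -> (mdeg m <= a + b)%N.
Proof.
move=> pa qb m /msuppM_le/allpairsP[[m1 m2] /= [pm1 qm2 ->]].
by rewrite mdegD leq_add ?pa ?qb.
Qed.

Lemma mdeg_mul_ge p q a b :
  (forall m, m \in msupp p -> (a <= mdeg m)%N) ->
  (forall m, m \in msupp q -> (b <= mdeg m)%N) ->
  forall m, m \in msupp (p * q) -> (a + b <= mdeg m)%N.
Proof.
move=> pa qb m /msuppM_le/allpairsP[[m1 m2] /= [pm1 qm2 ->]].
by rewrite mdegD leq_add ?pa ?qb.
Qed.

Lemma mdeg_exp_le p a k : (forall m, m \in msupp p -> (mdeg m <= a)%N) ->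
  forall m, m \in msupp (p ^+ k) -> (mdeg m <= k * a)%N.
Proof.
move=> pa; elim: k => [m|k IH]; last by rewrite exprS mulSn; apply: mdeg_mul_le.
by rewrite expr0 msupp1 inE => /eqP->; rewrite mdeg0.
Qed.

Lemma mdeg_exp_ge p a k : (forall m, m \in msupp p -> (a <= mdeg m)%N) ->
  forall m, m \in msupp (p ^+ k) -> (k * a <= mdeg m)%N.
Proof.
move=> pa; elim: k => [m|k IH]; last by rewrite exprS mulSn; apply: mdeg_mul_ge.
by rewrite expr0 mul0n.
Qed.

Lemma mdeg_power_prod fs a g D :
  (forall f, f \in fs -> forall m, m \in msupp f -> (mdeg m <= g)%N) ->
  all (fun i => i <= D)%N a ->
  forall m, m \in msupp (power_prod fs a) -> (mdeg m <= size fs * (D * g))%N.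
Proof.
elim: fs a => [|f fs IH] [|i a] fsg aD m;
  rewrite ?power_prod_cons /power_prod ?big_nil -/(power_prod _ _);
  try by rewrite msupp1 inE => /eqP->; rewrite mdeg0.
case/andP: aD => iD aD /=; rewrite mulSn; apply: mdeg_mul_le => [m'|m'].
  move=> /(mdeg_exp_le (fsg f (mem_head _ _)))/leq_trans; apply.
  by rewrite leq_mul2r iD orbT.
by apply: IH => // f' fsf'; apply: fsg; rewrite in_cons fsf' orbT.
Qed.

Lemma in_maxideal_mdeg f : in_maxideal f ->
  forall m, m \in msupp f -> (0 < mdeg m)%N.
Proof.
move=> [c ->] m; rewrite lt0n; apply: contraTneq => /eqP.
rewrite mdeg_eq0 => /eqP->; rewrite mcoeff_msupp negbK raddf_sum /=.
rewrite big1 // => i _; apply/eqP; rewrite -[_ == 0]negbK -mcoeff_msupp.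
apply/negP => /msuppM_le/allpairsP[[m1 m2] /= [_]].
rewrite msuppX inE => /eqP-> /(congr1 (@mdeg n)) /eqP.
by rewrite mdeg0 mdegD mdeg1 addn1.
Qed.

(* There are [D ^ d] products of powers with exponents below [D], whose
   monomials supported on [Z] are [O(D ^ #|Z|)] in number. *)
Lemma power_prod_dependent (Z : {set 'I_n}) fs : (#|Z| < size fs)%N ->
  exists A : seq (S * seq nat),
    [/\ A != [::], uniq (unzip2 A),
        forall t, t \in A -> t.1 \is a GRing.unit /\ size t.2 = size fs
      & forall m, (forall i, i \notin Z -> m i = 0%N) ->
          (\sum_(t <- A) t.1 * power_prod fs t.2)@_m = 0].
Proof.
move=> ltZd; set d := size fs in ltZd *.
pose g := (\max_(f <- fs) msize f)%N.
have fsg f : f \in fs -> forall m, m \in msupp f -> (mdeg m <= g)%N.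
  move=> fsf m /msize_mdeg_lt/ltnW/leq_trans; apply.
  by rewrite /g (big_rem f) //= leq_maxl.
(* Products with exponents at most [D] have degree below [B], and [B <= C * D.+1]. Hence [B ^ #|Z|
   <= D * D.+1 ^ #|Z| < D.+1 ^ #|Z|.+1 <= D.+1 ^ d]: there are more products than monomials on [Z]
   with exponents below [B]. *)
pose C := (d * g).+1; pose D := (C ^ #|Z|)%N; pose B := (d * (D * g)).+1.
pose T : finType := d.-tuple 'I_D.+1.
pose pf := pffun_on (ord0 : 'I_B) (mem Z) (mem 'I_B).
have cardB : (#|pf| < #|T|)%N.
  rewrite card_pffun_on card_tuple !card_ord.
  have leB : (B <= C * D.+1)%N.
    rewrite /B /C mulSn addSn ltnS mulnA mulnAC; apply: leq_trans (leq_addl _ _).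
    by rewrite leq_mul2l leqnSn orbT.
  apply: (@leq_ltn_trans ((C * D.+1) ^ #|Z|)%N); first by case: #|Z| => // e; rewrite leq_exp2r.
  rewrite expnMn -/D; apply: (@leq_trans (D.+1 ^ #|Z|.+1)%N).
    by rewrite expnS ltn_mul2r expn_gt0 /= ltnSn.
  exact: leq_pexp2l.
pose a (t : T) : seq nat := map val t.
pose mon (b : {ffun 'I_n -> 'I_B}) : 'X_{1..n} := [multinom (b i : nat) | i < n].
pose M : 'M[K]_(#|T|, #|pf|) := \matrix_(i, j)
  (power_prod fs (a (enum_val i)))@_(mon (enum_val j)).
(* Rows are products and columns are monomials, so the excess of rows yields a nontrivial linear
   relation among them. *)
have /rowV0Pn[v /sub_kermxP vM v0] : kermx M != 0.
  rewrite -mxrank_eq0 mxrank_ker subn_eq0 -ltnNge.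
  exact: leq_ltn_trans (rank_leq_col M) cardB.
pose c t : K := v 0 (enum_rank t).
pose A := [seq ((c t)%:MP_[n], a t) | t <- enum T & c t != 0].
have sumA m : (\sum_(t <- A) t.1 * power_prod fs t.2)@_m =
    \sum_t c t * (power_prod fs (a t))@_m.
  rewrite big_map big_filter big_enum_cond raddf_sum /= [LHS]big_mkcond /=.
  by apply: eq_bigr => t _; rewrite mcoeffCM; case: eqP => [->|]; rewrite ?mul0r.
exists A; split.
- apply: contraNneq v0 => A0; apply/eqP/rowP => i; rewrite mxE.
  apply: contraTeq isT => vi; have : enum_val i \in [seq t <- enum T | c t != 0].
    by rewrite mem_filter mem_enum /c enum_valK vi.
  by move/(map_f (fun t => ((c t)%:MP_[n], a t))); rewrite -/A A0.
- rewrite /unzip2 -map_comp map_inj_uniq ?filter_uniq -?enumT ?enum_uniq //.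
  by move=> s t /(inj_map val_inj)/val_inj.
- move=> t' /mapP[t]; rewrite mem_filter => /andP[ct _] -> /=.
  by rewrite size_map size_tuple; split=> //; apply: rmorph_unit; rewrite unitfE.
move=> m mZ; rewrite sumA.
(* A monomial with an exponent at least [B] has too large a degree to occur in any product; the
   others supported on [Z] are columns of [M]. *)
have [mB|/forallPn[i]] := boolP [forall i, m i < B]%N; last first.
  rewrite -leqNgt => Bm; apply: big1 => t _.
  rewrite [X in _ * X](_ : _ = 0) ?mulr0 //; apply/eqP; rewrite mcoeff_eq0.
  have aD : all (fun j => j <= D)%N (a t).
    by apply/allP => _ /mapP[j _ ->]; rewrite /= -ltnS ltn_ord.
  apply/negP => /(mdeg_power_prod fsg aD); rewrite leqNgt => /negP; apply; apply: leq_trans Bm _.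
  by rewrite mdegE (bigD1 i) //= leq_addr.
pose b : {ffun 'I_n -> 'I_B} := [ffun i => inord (m i)].
have bm : mon b = m.
  by apply/mnmP => i; rewrite mnmE ffunE inordK //; apply/forallP: i.
have pfb : b \in pf.
  apply/pffun_onP; split=> //; apply/subsetP => i; rewrite !inE ffunE.
  by apply: contraNT => /mZ->; apply/eqP/val_inj; rewrite /= inordK.
move/rowP/(_ (enum_rank_in pfb b)): vM; rewrite !mxE; apply: etrans.
rewrite [RHS](reindex (@enum_rank T)) /=; last by apply/onW_bij/enum_rank_bij.
by apply: eq_bigr => t _; rewrite mxE enum_rankK enum_rankK_in ?bm.
Qed.

End MonomialDegrees.

(** * The depth bound *)

Section Ideals.
Variables (K : fieldType) (n : nat).
Local Notation S := {mpoly K[n]}.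
Implicit Types (I J P : ideal S) (p q f : S) (m : 'X_{1..n}) (fs : seq S).

Lemma ideal_mulr I p q : q \in I -> p * q \in I.
Proof. by move=> Iq; apply: (@rpredZ _ S^o I p). Qed.

Lemma quotmod_pi_eq0 I p : quotmod_pi I p = 0 <-> p \in I.
Proof. by rewrite -(raddf0 (quotmod_pi I)) quotmod_piP subr0. Qed.

(** A form of monomiality that does not mention generators and passes easily along a filtration. *)
Definition monomial_closed I :=
  forall p, p \in I -> forall m, m \in msupp p -> ('X_[m] : S) \in I.

Lemma monomial_ideal_closed I : monomial_ideal I -> monomial_closed I.
Proof.
move=> [A IA] p /IA[s [sA ->]] m /msupp_sum_le/flattenP[ms].
case/mapP => t; rewrite filter_predT => st ->.
move=> /msuppM_le/allpairsP[[m1 m2] /= [_]]; rewrite msuppX inE => /eqP-> ->.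
apply/IA; exists [:: ('X_[m1], t.2)]; rewrite big_seq1 mpolyXD; split=> //.
by move=> t'; rewrite mem_seq1 => /eqP->; apply: (sA t).
Qed.

Lemma ideal_msupp I p :
  (forall m, m \in msupp p -> ('X_[m] : S) \in I) -> p \in I.
Proof.
move=> pI; rewrite (mpolyE p) big_seq; apply: (@rpred_sum _ I) => m /pI mI.
by rewrite -mul_mpolyC ideal_mulr.
Qed.

Lemma mpolyX_subU m i : m i != 0%N -> 'X_[m] = 'X_[m - U_(i)] * 'X_i :> S.
Proof.
move=> mi; rewrite -mpolyXD submK //; apply/mnm_lepP => j; rewrite mnm1E.
by case: eqP => // <-; rewrite lt0n.
Qed.

Lemma regular_seq_size_le I (Z : {set 'I_n}) u fs : monomial_closed I ->
  u \notin I -> (forall i, i \notin Z -> 'X_i * u \in I) ->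
  (forall f, f \in fs -> in_maxideal f) -> regular_seq (quotmod I) fs ->
  (size fs <= #|Z|)%N.
Proof.
move=> monI Iu Zu maxfs /regular_seq_weakly reg; rewrite leqNgt; apply/negP => ltZ.
have sub0 : submod_prop (eq^~ (0 : quotmod I)).
  by split=> // c x y -> ->; rewrite scaler0 addr0.
(* This exponent puts every monomial of [gs] in degree above [msize u], hence above all monomials of
   [u]. *)
pose gs := [seq f ^+ (msize u).+1 | f <- fs].
have szgs : size gs = size fs by rewrite size_map.
have gs_deg g : g \in gs -> forall m, m \in msupp g -> (msize u < mdeg m)%N.
  case/mapP => f /maxfs fmax -> m.
  by move/(mdeg_exp_ge (in_maxideal_mdeg fmax)); rewrite muln1.
have [] := @power_prod_dependent _ _ Z gs; first by rewrite szgs.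
move=> A [A0 uA tA relA].
(* Every monomial of the relation contains a variable outside [Z], and such a variable multiplies
   [u] into [I]. *)
have {relA} /quotmod_pi_eq0 :
    (\sum_(t <- A) t.1 * power_prod gs t.2) * u \in I.
  set q := (\sum_(t <- A) _) in relA *.
  rewrite (mpolyE q) big_distrl /= big_seq; apply: (@rpred_sum _ I) => m qm.
  rewrite -mul_mpolyC -mulrA ideal_mulr //.
  have /existsP[i /andP[Zi mi]] : [exists i, (i \notin Z) && (m i != 0%N)].
    apply: contraLR qm => /existsPn mZ; rewrite -mcoeff_eq0 relA // => i Zi.
    by have := mZ i; rewrite Zi negbK => /eqP.
  by rewrite (mpolyX_subU mi) -mulrA ideal_mulr // Zu.
rewrite (quotmod_piZ _ _ (u : S^o)).
move/(weakly_regular_torsion sub0 (weakly_regularX (msize u) sub0 reg) A0 uA tA).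
move/in_mulmodE => [w uw].
pose y := \sum_(j < size gs) gs`_j * (repr (w j : Quotient.quot I) : S).
have /quotmod_piP uy : quotmod_pi I u = quotmod_pi I y.
  rewrite uw (raddf_sum (quotmod_pi I)); apply: eq_bigr => j _.
  apply: etrans (esym (quotmod_piZ I gs`_j (repr (w j : Quotient.quot I)))).
  by rewrite /quotmod_pi reprK.
have y_deg m : m \in msupp y -> (msize u < mdeg m)%N.
  move=> /msupp_sum_le/flattenP[ms /mapP[j _ ->]].
  move=> /msuppM_le/allpairsP[[m1 m2] /= [/gs_deg lt_m1 _ ->]].
  by rewrite mdegD ltn_addr // lt_m1 ?mem_nth.
(* The monomials of [y] have too high a degree to cancel those of [u], so each monomial of [u]
   occurs in [u - y], an element of the monomial ideal [I]. *)
case/negP: Iu; apply: ideal_msupp => m um; apply: (monI _ uy).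
rewrite mcoeff_msupp mcoeffB [y@_m](_ : _ = 0) ?subr0 -?mcoeff_msupp //.
apply/eqP; rewrite mcoeff_eq0; apply/negP => /y_deg.
by rewrite ltnNge ltnW ?msize_mdeg_lt.
Qed.

(** [grade] is specified only if the lengths of regular sequences have a maximum. They do: the empty
    sequence is regular because [u] is nonzero in [S/I], and [regular_seq_size_le] bounds all
    lengths. *)
Lemma depth_le I (Z : {set 'I_n}) u : monomial_closed I ->
  u \notin I -> (forall i, i \notin Z -> 'X_i * u \in I) ->
  (depth (quotmod I) <= #|Z|)%N.
Proof.
move=> monI Iu Zu.
pose len d := exists fs : seq S,
  [/\ forall f, f \in fs -> in_maxideal f, regular_seq (quotmod I) fs
    & size fs = d].
have len_le d : len d -> (d <= #|Z|)%N.
  by move=> [fs [maxfs reg <-]]; exact: (regular_seq_size_le monI Iu Zu).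
have len0 : len 0%N.
  exists [::]; split=> //; split=> //; exists (quotmod_pi I u).
  by rewrite in_mulmod_nil quotmod_pi_eq0; apply/negP.
suff [d [lend maxd]] : exists d, len d /\ forall e, len e -> (e <= d)%N.
  suff -> : depth (quotmod I) = d by apply: len_le.
  by apply: gradeE; split=> // fs maxfs reg; apply: maxd; exists fs.
apply: NNPP => nomax; suff : forall d, exists2 e, len e & (d <= e)%N.
  by case/(_ #|Z|.+1) => e /len_le leZ /leq_trans/(_ leZ); rewrite ltnn.
elim=> [|d [e lene led]]; first by exists 0%N.
apply: NNPP => nolt; apply: nomax; exists e; split=> // e' lene'.
rewrite leqNgt; apply/negP => lte; apply: nolt; exists e' => //.
exact: leq_ltn_trans lte.
Qed.

End Ideals.

(** * Prime filtrations and Stanley decompositions *)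

Section Filtration.
Variables (K : fieldType) (n : nat).
Local Notation S := {mpoly K[n]}.
Implicit Types (I : ideal S) (p q f h : S) (m : 'X_{1..n}).

Fact quot_preim_closed I (M : submodule (quotmod I)) :
  submod_closed [pred p : S^o | quotmod_pi I p \in M].
Proof.
split=> [|c p q]; rewrite !inE; first by rewrite raddf0 rpred0.
by move=> Mp Mq; rewrite linearP rpredD // rpredZ.
Qed.

Definition quot_preim I (M : submodule (quotmod I)) : ideal S :=
  Submodule (quot_preim_closed M).

(** A degree in the fine grading determines the exponent vector, so each component is at most
    one-dimensional. *)
Lemma homogeneous_monomial (a : {ffun 'I_n -> int}) p :
  graded_ring a p -> p != 0 -> p = p@_(mlead p) *: 'X_[mlead p].
Proof.
move=> pa p0; have eq_lead m : m \in msupp p -> m = mlead p.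
  move=> pm; apply/mnmP => i; have := pa _ (mlead_supp p0) i.
  by rewrite (pa _ pm) => -[].
apply/mpolyP => m; rewrite mcoeffZ mcoeffX.
have [->|ne] := eqVneq (mlead p) m; first by rewrite mulr1.
rewrite mulr0; apply/eqP; rewrite mcoeff_eq0; apply: contra ne => /eq_lead ->.
by rewrite eqxx.
Qed.

(** The class of 1 generates [S/P(-a)] in degree [a], with annihilator [P]. Its preimage lifts to a
    homogeneous [p] in [S], which is a scalar multiple of a monomial. *)
Lemma cyclic_factor I (M M' : submodule (quotmod I)) (P : ideal S) a :
  {subset M <= M'} -> (1 : S) \notin P ->
  multigraded_iso
    (graded_quot (graded_sub (graded_quot (@graded_ring K n) I) M')
       (submod_restr M' M))
    (graded_shift (graded_quot (@graded_ring K n) P) a) ->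
  exists u : 'X_{1..n},
    [/\ 'X_[u] \in quot_preim M',
        forall p, p \in quot_preim M' -> exists h, p - h * 'X_[u] \in quot_preim M
      & forall f, (f * 'X_[u] \in quot_preim M) = (f \in P)].
Proof.
move=> subM P1 [F [bijF grF]]; have [G FK GK] := bijF.
have deg1 : graded_shift (graded_quot (@graded_ring K n) P) a a (quotmod_pi P 1).
  exists 1 => // m; rewrite msupp1 inE => /eqP-> i.
  by rewrite !ffunE subrr mnm0E.
have [w [p pa wp] Gw] : graded_quot (graded_sub (graded_quot (@graded_ring K n) I) M')
    (submod_restr M' M) a (G (quotmod_pi P 1)).
  by apply/grF; rewrite GK.
have piP f : quotmod_pi P f = f *: quotmod_pi P 1.
  by rewrite -[in LHS](mulr1 f); apply: (quotmod_piZ P f (1 : S^o)).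
have Fw f : F (quotmod_pi _ (f *: w)) = quotmod_pi P f.
  by rewrite linearZ linearZ /= -Gw GK -piP.
have annw f : (f *: submod_val w \in M) = (f \in P).
  apply/idP/idP => [Mf|Pf].
    apply/quotmod_pi_eq0; rewrite -Fw.
    rewrite (_ : quotmod_pi _ (f *: w) = 0) ?raddf0 //.
    by rewrite -(raddf0 (quotmod_pi _)); apply/quotmod_piP; rewrite subr0.
  have /(congr1 G) : F (quotmod_pi (submod_restr M' M) (f *: w)) = F 0.
    by rewrite Fw raddf0; apply/quotmod_pi_eq0.
  by rewrite !FK -(raddf0 (quotmod_pi _)) => /quotmod_piP; rewrite subr0.
have genw x : x \in M' -> exists h, x - h *: submod_val w \in M.
  move=> M'x; have [h hE] := quotmod_pi_surj (F (quotmod_pi _ (Submod M'x))).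
  exists h; have := hE; rewrite -Fw => /(bij_inj bijF)/esym.
  by move=> /quotmod_piP.
(* If [p] were zero, 1 would annihilate the generator and lie in [P]. *)
have p0 : p != 0.
  apply: contraNneq P1 => p0; rewrite -annw scale1r wp p0 raddf0.
  exact: rpred0.
have := homogeneous_monomial pa p0.
set c := p@_(mlead p); set u := mlead p => pE.
have c0 : c != 0 by rewrite mleadc_eq0.
have pE' : p = c%:MP_[n] * 'X_[u] by rewrite mul_mpolyC.
have uE : 'X_[u] = c^-1%:MP_[n] * p.
  by rewrite pE' mulrA -mpolyCM mulVf // mpolyC1 mul1r.
have piE f : quotmod_pi I (f * p) = f *: submod_val w.
  by rewrite wp; apply: (quotmod_piZ I f (p : S^o)).
have Mw : submod_val w \in M' by case: (w).
exists u; split=> [|q M'q|f].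
- by rewrite inE /= uE piE rpredZ.
- have [h hM] := genw _ M'q; exists (h * c%:MP_[n]).
  by rewrite inE /= -mulrA -pE' raddfB /= piE.
rewrite inE /= uE mulrA piE annw; apply/idP/idP => [Pf|Pf]; last first.
  by rewrite mulrC ideal_mulr.
have := ideal_mulr c%:MP_[n] Pf.
by rewrite mulrCA -mpolyCM mulfV // mpolyC1 mulr1.
Qed.

(* [J i] stands for the preimage in [S] of the i-th module of a prime
   filtration of [S/I]. *)
Record monomial_filtration I r (J P : nat -> ideal S) (u : nat -> 'X_{1..n}) :
    Prop := MonomialFiltration {
  filtration0 : J 0%N =i I;
  filtrationT : forall p, p \in J r;
  filtration_sub : forall i, (i < r)%N -> {subset J i <= J i.+1};
  filtration_prime : forall i, (i < r)%N -> prime_ideal (P i);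
  filtration_mem : forall i, (i < r)%N -> ('X_[u i] : S) \in J i.+1;
  filtration_gen : forall i, (i < r)%N -> forall p, p \in J i.+1 ->
    exists h, p - h * 'X_[u i] \in J i;
  filtration_ann : forall i, (i < r)%N ->
    forall f, (f * 'X_[u i] \in J i) = (f \in P i)
}.

Lemma pretty_clean_filtration I : pretty_clean I ->
  exists r J P u, monomial_filtration I r J P u /\
    forall i j, (i < j < r)%N -> {subset P i <= P j} -> P i =i P j.
Proof.
move=> [r [M [P [a [[M0 Mr] _ subM isoM prettyP]]]]].
(* The bound on [i] sits under the existential so that choice gives a total function, arbitrary from
   [r] on. *)
have ex_u i : exists u : 'X_{1..n}, (i < r)%N ->
    [/\ 'X_[u] \in quot_preim (M i.+1),
        forall p, p \in quot_preim (M i.+1) ->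
          exists h, p - h * 'X_[u] \in quot_preim (M i)
      & forall f, (f * 'X_[u] \in quot_preim (M i)) = (f \in P i)].
  have [ltir|] := boolP (i < r)%N; last by exists 0%MM.
  have [_ [P1 _] iso_i] := isoM i ltir.
  by have [u uP] := cyclic_factor (subM i ltir) P1 iso_i; exists u.
pose u i := sval (ClassicalEpsilon.constructive_indefinite_description _ (ex_u i)).
have uP i : (i < r)%N -> _ := svalP
  (ClassicalEpsilon.constructive_indefinite_description _ (ex_u i)).
exists r, (fun i => quot_preim (M i)), P, u; split=> //; split.
- move=> p; rewrite inE /= M0; apply/eqP/idP => /quotmod_pi_eq0 //.
- by move=> p; rewrite inE /= Mr.
- by move=> i ltir p; rewrite !inE; apply: subM.
- by move=> i /isoM[].
- by move=> i /uP[].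
- by move=> i /uP[].
- by move=> i /uP[].
Qed.

Section Fixed.
Variables (I : ideal S) (r : nat) (J P : nat -> ideal S) (u : nat -> 'X_{1..n}).
Hypothesis filt : monomial_filtration I r J P u.

Lemma filtration_homo i j : (i <= j <= r)%N -> {subset J i <= J j}.
Proof.
case/andP=> leij; rewrite -(subnKC leij); elim: (j - i)%N => [|k IH].
  by rewrite addn0 => _ p.
by rewrite addnS => ltr p /(IH (ltnW ltr)); apply: (filtration_sub filt).
Qed.

(** Each step adds the single monomial generator ['X_[u i]] to the ideal before it. *)
Lemma filtration_monomial i : monomial_closed I -> (i <= r)%N ->
  monomial_closed (J i).
Proof.
move=> monI; elim: i => [_ p|i IH ltir p].
  by rewrite (filtration0 filt) => Ip m pm; rewrite (filtration0 filt) (monI p).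
move=> /(filtration_gen filt ltir)[h Jph] m.
rewrite -[p](subrK (h * 'X_[u i])) => /msuppD_le; rewrite mem_cat => /orP[pm|].
  by apply: (filtration_sub filt ltir); apply: (IH (ltnW ltir) _ Jph).
move=> /msuppM_le/allpairsP[[m1 m2] /= [_]]; rewrite msuppX inE => /eqP-> ->.
by rewrite mpolyXD ideal_mulr // (filtration_mem filt).
Qed.

Lemma prime_mpolyX (Q : ideal S) m : prime_ideal Q ->
  (('X_[m] : S) \in Q) = [exists k, (m k != 0%N) && (('X_k : S) \in Q)].
Proof.
move=> [Q1 primeQ]; apply/idP/existsP => [Qm|[k /andP[mk Qk]]]; last first.
  by rewrite (mpolyX_subU K mk) ideal_mulr.
apply: NNPP => noQ; move: Qm; apply/negP; rewrite mpolyXE_id.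
pose notQ p := p \notin Q.
have notQM p q : notQ p -> notQ q -> notQ (p * q).
  by rewrite /notQ => Qp Qq; apply/negP => /primeQ; rewrite (negPf Qp) (negPf Qq).
apply: (big_ind notQ) => // k _; have [Qk|] := boolP (('X_k : S) \in Q).
  have [->|mk] := eqVneq (m k) 0%N; first by rewrite expr0.
  by case: noQ; exists k; rewrite mk Qk.
by move=> Qk; elim: (m k) => [|e IH]; rewrite ?expr0 // exprS; apply: notQM.
Qed.

Definition free_vars i : {set 'I_n} := [set k | ('X_k : S) \notin P i].

(** By [filtration_ann], a multiple ['X_[v] * 'X_[u i]] avoids [J i] exactly when ['X_[v]] avoids
    [P i], which for a prime means that [v] involves free variables only. *)
Lemma stanley_cellP i m : monomial_closed I -> (i < r)%N ->
  (exists v : 'X_{1..n},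
     (forall k, k \notin free_vars i -> v k = 0%N) /\ m = (u i + v)%MM) <->
  (('X_[m] : S) \in J i.+1) && (('X_[m] : S) \notin J i).
Proof.
move=> monI ltir.
have XvP v : (('X_[v] : S) \notin P i) <->
    (forall k, k \notin free_vars i -> v k = 0%N).
  rewrite (prime_mpolyX _ (filtration_prime filt ltir)); split=> [/existsPn vP k|vZ].
    by rewrite inE negbK => Pk; apply/eqP; have := vP k; rewrite Pk andbT negbK.
  apply/existsPn => k; apply/negP => /andP[/eqP vk Pk]; apply: vk.
  by apply: vZ; rewrite inE negbK.
split=> [[v [vZ ->]]|/andP[Jm Jm']].
  rewrite addmC mpolyXD ideal_mulr ?(filtration_mem filt) //=.
  by rewrite (filtration_ann filt ltir); apply/XvP.
(* If [u i] did not divide [m], then [m] would survive in ['X_[m] - h * 'X_[u i]], an element of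
   [J i], and [J i] would contain ['X_[m]]. *)
have leum : (u i <= m)%MM.
  apply: contraNT Jm' => leum; have [h Jh] := filtration_gen filt ltir Jm.
  apply: (filtration_monomial monI (ltnW ltir) Jh).
  rewrite mcoeff_msupp mcoeffB mcoeffX eqxx.
  suff /eqP-> : (h * 'X_[u i])@_m == 0 by rewrite subr0 oner_neq0.
  rewrite mcoeff_eq0; apply: contra leum.
  move=> /msuppM_le/allpairsP[[m1 m2] /= [_]]; rewrite msuppX inE => /eqP-> ->.
  exact: lem_addl.
exists (m - u i)%MM; split; last by rewrite addmC submK.
by apply/XvP; rewrite -(filtration_ann filt ltir) -mpolyXD submK.
Qed.

(** Take [g] to be a product of elements of [P j] outside [Q], one for each [j < i]. Each factor
    moves [J j.+1] into [J j], and primality keeps the product outside [Q]. *)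
Lemma filtration_kill Q i : prime_ideal Q -> (i <= r)%N ->
  (forall j, (j < i)%N -> ~ {subset P j <= Q}) ->
  exists2 g, g \notin Q & forall p, p \in J i -> g * p \in I.
Proof.
move=> primeQ; elim: i => [_ _|i IH ltir notsub].
  exists 1; first by case: primeQ.
  by move=> p; rewrite (filtration0 filt) mul1r.
have [|g Qg gI] := IH (ltnW ltir); first by move=> j ltj; apply/notsub/ltnW.
have [h Ph Qh] : exists2 h, h \in P i & h \notin Q.
  apply: NNPP => noh; apply: (notsub i) => // h Ph.
  by apply/idPn => Qh; apply: noh; exists h.
exists (g * h).
  by apply/negP => /(proj2 primeQ); rewrite (negPf Qg) (negPf Qh).
move=> p /(filtration_gen filt ltir)[s Js]; rewrite -mulrA gI //.
rewrite -[p](subrK (s * 'X_[u i])) mulrDr; apply: (@rpredD _ (J i)).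
  exact: ideal_mulr.
by rewrite mulrCA ideal_mulr // (filtration_ann filt).
Qed.

(* Each [P i] is an associated prime of [S/I]: at the first index carrying
   [P i], some element outside [P i] kills the lower part of the filtration. *)
Lemma filtration_assoc i :
  (forall i j, (i < j < r)%N -> {subset P i <= P j} -> P i =i P j) ->
  (i < r)%N ->
  exists2 v, v \notin I & forall f, f \in P i -> f * v \in I.
Proof.
move=> prettyP; elim/ltn_ind: i => i IH ltir.
(* If an earlier prime is contained in [P i], pretty cleanness makes them equal and the induction
   hypothesis applies. *)
have [[j ltji subji]|noj] := classic (exists2 j, (j < i)%N & {subset P j <= P i}).
  have [v Iv vP] := IH j ltji (ltn_trans ltji ltir).
  by exists v => // f; rewrite -(prettyP j i) ?ltji //; apply: vP.
have [|||g Pg gI] := @filtration_kill (P i) i.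
- exact: (filtration_prime filt).
- exact: ltnW.
- by move=> j ltji subji; apply: noj; exists j.
(* [P i] sends ['X_[u i]] into [J i], which [g] kills modulo [I]; and [g * 'X_[u i]] in [I], hence
   in [J i], would put [g] in [P i]. *)
exists (g * 'X_[u i]) => [|f Pf]; last first.
  by rewrite mulrCA gI // (filtration_ann filt).
rewrite -(filtration_ann filt ltir) in Pg; apply: contra Pg.
have le0ir : (0 <= i <= r)%N by rewrite leq0n ltnW.
by rewrite -(filtration0 filt) => /(filtration_homo le0ir).
Qed.

Lemma filtration_cell_ex p : p \notin I ->
  exists i : 'I_r, (p \in J i.+1) && (p \notin J i).
Proof.
move=> Ip; have exJ : exists i, p \in J i by exists r; apply: (filtrationT filt).
case: (ex_minnP exJ) => -[|i] Ji mini.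
  by rewrite (filtration0 filt) (negPf Ip) in Ji.
have ltir : (i < r)%N by apply: mini; apply: (filtrationT filt).
exists (Ordinal ltir); rewrite /= Ji /=.
by apply/negP => /mini; rewrite ltnn.
Qed.

Lemma filtration_cell_uniq p (i j : 'I_r) :
  (p \in J i.+1) && (p \notin J i) -> (p \in J j.+1) && (p \notin J j) -> i = j.
Proof.
wlog leij : i j / (i <= j)%N.
  by move=> W; have [/W//|/ltnW/W Wji pi pj] := leqP i j; apply/esym/Wji.
move=> /andP[Ji _] /andP[_ Jj]; apply/val_inj/eqP; rewrite eqn_leq leij /=.
rewrite leqNgt; apply: contra Jj => ltij.
by apply: (filtration_homo _ Ji); rewrite ltij ltnW.
Qed.

End Fixed.

(** * Direct sums of spans of monomials *)

Definition mpoly_restr (B : pred 'X_{1..n}) p : S :=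
  \sum_(m <- msupp p | B m) p@_m *: 'X_[m].

Lemma mcoeff_restr (B : pred 'X_{1..n}) p m :
  (mpoly_restr B p)@_m = if B m then p@_m else 0.
Proof.
rewrite /mpoly_restr raddf_sum /= big_mkcond /=.
have [pm|pm] := boolP (m \in msupp p).
  rewrite (bigD1_seq m) ?msupp_uniq //= mcoeffZ mcoeffX eqxx mulr1.
  rewrite big1_seq ?addr0 // => k /andP[km _].
  by rewrite mcoeffZ mcoeffX (negPf km) mulr0 if_same.
rewrite (_ : p@_m = 0); last by apply/eqP; rewrite mcoeff_eq0.
rewrite if_same big1_seq // => k /andP[_ pk]; rewrite mcoeffZ mcoeffX.
have [km|_] := eqVneq k m; last by rewrite mulr0 if_same.
by rewrite -km pk in pm.
Qed.

(** As the [B i] partition [A], the component of [p] at [i] must be its restriction to [B i]. The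
    Boolean [B] mirrors [E] so that this restriction is a filtered sum. *)
Lemma direct_sum_mon_span r (A : 'X_{1..n} -> Prop)
    (E : 'I_r -> 'X_{1..n} -> Prop) (B : 'I_r -> pred 'X_{1..n}) :
  (forall i m, E i m <-> B i m) ->
  (forall i m, B i m -> A m) -> (forall m, A m -> exists i, B i m) ->
  (forall i j m, B i m -> B j m -> i = j) ->
  direct_sum_decomposition (mon_span (K := K) A) (fun i => mon_span (E i)).
Proof.
move=> EB BA AB uniqB; split=> [i p pE m /pE/EB|p pA]; first exact: BA.
exists [ffun i => mpoly_restr (B i) p]; split=> [|q [qE pq]].
  split=> [i m|].
    rewrite ffunE mcoeff_msupp mcoeff_restr; case: ifP => [Bm _|_]; first exact/EB.
    by rewrite eqxx.
  apply/mpolyP => m; rewrite raddf_sum /=.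
  under eq_bigr do rewrite ffunE mcoeff_restr.
  have [pm|pm] := boolP (m \in msupp p); last first.
    have -> : p@_m = 0 by apply/eqP; rewrite mcoeff_eq0.
    by rewrite big1 // => i _; rewrite if_same.
  have [i Bi] := AB m (pA m pm); rewrite (bigD1 i) //= Bi big1 ?addr0 // => j ji.
  by case: ifP => // Bj; rewrite (uniqB _ _ _ Bi Bj) eqxx in ji.
apply/ffunP => i; apply/mpolyP => m; rewrite ffunE mcoeff_restr.
have q0 j : ~~ B j m -> (q j)@_m = 0.
  by move=> Bj; apply/eqP; rewrite mcoeff_eq0; apply: contra Bj => /qE/EB.
case: ifPn => [Bi|/q0 //]; rewrite pq raddf_sum /= (bigD1 i) //= big1 ?addr0 //.
move=> j ji; apply: q0; apply: contra ji => Bj.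
by rewrite (uniqB _ _ _ Bi Bj).
Qed.

End Filtration.

Theorem theorem6p5 (K : fieldType) (n : nat) (I : ideal {mpoly K[n]}) :
  monomial_ideal I -> pretty_clean I ->
  exists (r : nat) (u : 'I_r -> 'X_{1..n}) (Z : 'I_r -> {set 'I_n}),
    stanley_decomposition I u Z /\
    forall i : 'I_r, (depth (quotmod I) <= #|Z i|)%N.
Proof.
move=> /monomial_ideal_closed monI.
move=> /pretty_clean_filtration[r [J [P [u [filt prettyP]]]]].
exists r, u, (fun i => free_vars P i); split=> [|i]; last first.
  have [v Iv vP] := filtration_assoc filt prettyP (ltn_ord i).
  by apply: (depth_le monI Iv) => k; rewrite inE negbK => /vP.
(* The cells are the monomials of [J i.+1] outside [J i]; they partition those outside [I] because
   the [J i] form a chain from [I] up to [S]. *)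
apply: (@direct_sum_mon_span _ _ _ _ _ (fun i m =>
          ('X_[m] \in J i.+1) && ('X_[m] \notin J i))) => [i m|i m|m Im|i j m].
- exact: (stanley_cellP filt).
- move=> /andP[_]; apply: contra; rewrite -(filtration0 filt).
  by apply: (filtration_homo filt (i := 0%N)); rewrite leq0n ltnW.
- exact: (filtration_cell_ex filt).
- exact: (filtration_cell_uniq filt).
Qed.
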